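(* Consider the HSLM algorithm (described in the context) applied to $F(x)=\tfrac12\|\mathbf r(x)\|^2$ from $x_0\in\mathbb R^n$, and let $\mathcal L:=\{x\in\mathbb R^n: F(x)\le F(x_0)\}$. Assume: (1) $F$ is bounded below on $\mathcal L$. (2) $\nabla F$ is Lipschitz continuous on an open neighborhood $\mathcal N$ of $\mathcal L$: there exists $L_1>0$ such that $\|\nabla F(x)-\nabla F(y)\|\le L_1\|x-y\|$ for all $x,y\in\mathcal N$. (3) There exists $\eta_{\min}\in(0,1]$ such that $\|V_k^\top g_k\|^2/\|g_k\|^2\ge\eta_{\min}$ for all iterations $k$ with $g_k\ne0$. (4) There exist $m_B,M_B$ such that $0<m_B\le\lambda_{\min}(B_k)\le\lambda_{\max}(B_k)\le M_B<\infty$ for all $k$. Then either the algorithm terminates at a stationary point (i.e. $g_k=0$ for some $k$), or $$\liminf_{k\to\infty}\|g_k\|=0.$$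
   Context: Norms are Euclidean (spectral for matrices). $\mathbf r:\mathbb R^n\to\mathbb R^m$ is a continuously differentiable residual map with Jacobian $\mathbf J(x)\in\mathbb R^{m\times n}$; $F(x)=\tfrac12\|\mathbf r(x)\|^2$ and $\mathbf g(x)=\nabla F(x)=\mathbf J(x)^\top\mathbf r(x)$. At an iterate $x_k$ write $r_k=\mathbf r(x_k)$, $J_k=\mathbf J(x_k)$, $g_k=\mathbf g(x_k)$. HSLM algorithm. Fixed parameters: $\mu_0>0$, $\delta>0$, $\eta_{\min}\in(0,1]$, $\alpha,\beta\in(0,1)$, thresholds $\rho_{\mathrm{low}}\le\rho_{\mathrm{high}}$, factors $\mu_{up},\mu_{down}>1$. The algorithm terminates at iteration $k$ if $g_k=0$. Otherwise, iteration $k$ is as follows. - A matrix $V_k\in\mathbb R^{n\times p}$ with orthonormal columns is constructed ($p$ may depend on $k$) from candidate directions (normalized gradient, recent steps, Krylov/Lanczos vectors, random curvature probes), and the subspace is enlarged until $\|V_k^\top g_k\|^2/\|g_k\|^2\ge\eta_{\min}$. For the analysis, $V_k$ can be any matrix with orthonormal columns having the stated properties. - Let $J_{k,p}=J_kV_k=U_k\Sigma_{k,p}Z_k^\top$ be a (thin) singular value decomposition: $U_k\in\mathbb R^{m\times p}$ has orthonormal columns, $\Sigma_{k,p}=\mathrm{diag}(\sigma_{k,1},\dots,\sigma_{k,p})$ with $\sigma_{k,i}\ge0$, and $Z_k\in\mathbb R^{p\times p}$ is orthogonal. - Let $D_{k,p}=\mathrm{diag}(d_{k,1},\dots,d_{k,p})$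 with $d_{k,i}=\max(\sigma_{k,i}^2,\delta)$, and $B_k=\Sigma_{k,p}^2+\mu_kD_{k,p}$. - Let $y_k$ solve $B_ky_k=-\Sigma_{k,p}U_k^\top r_k$ and set $s_k=V_kZ_ky_k$. - (Armijo backtracking) Let $t_k=\beta^{j_k}$, where $j_k\ge0$ is the smallest nonnegative integer such that $F(x_k+t_ks_k)\le F(x_k)+\alpha t_k g_k^\top s_k$; set $x_{k+1}=x_k+t_ks_k$. - (Damping update) With $m_k(s)=\tfrac12\|r_k+J_ks\|^2+\tfrac{\mu_k}{2}\|D_{k,p}^{1/2}Z_k^\top V_k^\top s\|^2$ and $\rho_k=\dfrac{F(x_k)-F(x_k+t_ks_k)}{m_k(0)-m_k(t_ks_k)}$, set $\mu_{k+1}=\mu_k/\mu_{down}$ if $\rho_k\ge\rho_{\mathrm{high}}$, $\mu_{k+1}=\mu_k$ if $\rho_{\mathrm{low}}\le\rho_k<\rho_{\mathrm{high}}$, and $\mu_{k+1}=\mu_k\mu_{up}$ if $\rho_k<\rho_{\mathrm{low}}$. In particular $\mu_k>0$ for all $k$. *)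

(* Defs.v *)
From HB Require Import structures.
From mathcomp Require Import all_boot all_order all_algebra.
From mathcomp Require Import all_classical all_reals all_analysis.

Set Implicit Arguments.
Unset Strict Implicit.
Unset Printing Implicit Defensive.

Import Order.TTheory GRing.Theory Num.Theory.
Import numFieldNormedType.Exports.

Local Open Scope classical_set_scope.
Local Open Scope ring_scope.

(* Vectors are rows, as required by the library's Jacobian ['J]: the product
   of a matrix M with a vector v is written [v *m M^T], and a symmetric
   (diagonal) factor is written without its transpose. *)

Definition dotv (R : realType) n (u v : 'rV[R]_n) : R := (u *m v^T) 0 0.

(* The norm `|v| of the library on 'rV[R]_n is the sup norm; it induces the same
   topology and the same differentials. *)
Definition enorm (R : realType) n (v : 'rV[R]_n) : R := Num.sqrt (dotv v v).

Definition gradient (R : realType) n (F : 'rV[R]_n -> R) (x : 'rV[R]_n) :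
  'rV[R]_n := \row_i 'D_(delta_mx 0 i) F x.

(* ['J r x] has entry d r_j / d x_i at (i, j), hence the transpose. *)
Definition jac (R : realType) n m (r : 'rV[R]_n -> 'rV[R]_m) (x : 'rV[R]_n) :
  'M[R]_(m, n) := ('J r x)^T.

Definition continuously_differentiable (R : realType) n m
    (r : 'rV[R]_n -> 'rV[R]_m) : Prop :=
  (forall x, differentiable r x) /\ continuous (jac r).

Definition half_sq (R : realType) n m (r : 'rV[R]_n -> 'rV[R]_m)
  (x : 'rV[R]_n) : R := 2^-1 * enorm (r x) ^+ 2.

Definition orthonormal_cols (R : realType) m p (A : 'M[R]_(m, p)) : Prop :=
  A^T *m A = 1%:M.

(* Meant for symmetric matrices of positive size. *)
Definition lambda_min (R : realType) p (A : 'M[R]_p) : R :=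
  inf [set a | eigenvalue A a].
Definition lambda_max (R : realType) p (A : 'M[R]_p) : R :=
  sup [set a | eigenvalue A a].

Record hslm_params (R : realType) := HSLMParams {
  mu0 : R;
  delta : R;
  eta_min : R;
  alpha : R;
  beta : R;
  rho_low : R;
  rho_high : R;
  mu_up : R;
  mu_down : R;
  mu0_gt0 : 0 < mu0;
  delta_gt0 : 0 < delta;
  eta_min_bounds : 0 < eta_min <= 1;
  alpha_bounds : 0 < alpha < 1;
  beta_bounds : 0 < beta < 1;
  rho_low_le_high : rho_low <= rho_high;
  mu_up_gt1 : 1 < mu_up;
  mu_down_gt1 : 1 < mu_down
}.

(* Objects chosen during one iteration: the subspace basis V, the factors of
   J V = U diag(sigma) Z^T, and the reduced step y. *)
Record hslm_data (R : realType) (n m : nat) := HSLMData {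
  dimp : nat;
  Vmx : 'M[R]_(n, dimp);
  Umx : 'M[R]_(m, dimp);
  sigma : 'rV[R]_dimp;
  Zmx : 'M[R]_dimp;
  ystep : 'rV[R]_dimp
}.

Definition is_thin_svd (R : realType) m p (A : 'M[R]_(m, p))
    (U : 'M[R]_(m, p)) (s : 'rV[R]_p) (Z : 'M[R]_p) : Prop :=
  [/\ orthonormal_cols U, orthonormal_cols Z, (forall i, 0 <= s 0 i)
    & A = U *m diag_mx s *m Z^T].

Definition dvec (R : realType) n m (prm : hslm_params R)
    (I : hslm_data R n m) : 'rV[R]_(dimp I) :=
  \row_i Num.max (sigma I 0 i ^+ 2) (delta prm).

Definition Bmx (R : realType) n m (prm : hslm_params R) (mu : R)
    (I : hslm_data R n m) : 'M[R]_(dimp I) :=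
  diag_mx (sigma I) *m diag_mx (sigma I) + mu *: diag_mx (dvec prm I).

Definition sstep (R : realType) n m (I : hslm_data R n m) : 'rV[R]_n :=
  ystep I *m (Vmx I *m Zmx I)^T.

Definition armijo (R : realType) n (prm : hslm_params R) (F : 'rV[R]_n -> R)
    (x s : 'rV[R]_n) (t : R) : Prop :=
  F (x + t *: s) <= F x + alpha prm * t * dotv (gradient F x) s.

Definition first_armijo (R : realType) n (prm : hslm_params R)
    (F : 'rV[R]_n -> R) (x s : 'rV[R]_n) (j : nat) : Prop :=
  armijo prm F x s (beta prm ^+ j) /\
  forall i, (i < j)%N -> ~ armijo prm F x s (beta prm ^+ i).

Definition model (R : realType) n m (prm : hslm_params R)
    (r : 'rV[R]_n -> 'rV[R]_m) (x : 'rV[R]_n) (mu : R) (I : hslm_data R n m)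
    (s : 'rV[R]_n) : R :=
  2^-1 * enorm (r x + s *m (jac r x)^T) ^+ 2 +
  mu / 2 * enorm (s *m Vmx I *m Zmx I *m
                  diag_mx (map_mx Num.sqrt (dvec prm I))) ^+ 2.

Definition gain_ratio (R : realType) n m (prm : hslm_params R)
    (r : 'rV[R]_n -> 'rV[R]_m) (x : 'rV[R]_n) (mu : R) (I : hslm_data R n m)
    (s : 'rV[R]_n) : R :=
  (half_sq r x - half_sq r (x + s)) /
  (model prm r x mu I 0 - model prm r x mu I s).

Definition update_mu (R : realType) (prm : hslm_params R) (mu rho : R) : R :=
  if rho_high prm <= rho then mu / mu_down prm
  else if rho_low prm <= rho then mu
  else mu * mu_up prm.

Definition captured (R : realType) n m (r : 'rV[R]_n -> 'rV[R]_m)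
    (x : 'rV[R]_n) (I : hslm_data R n m) : R :=
  enorm (gradient (half_sq r) x *m Vmx I) ^+ 2 /
  enorm (gradient (half_sq r) x) ^+ 2.

(* The new iterate is prescribed for the first admissible backtracking exponent,
   whose existence is not assumed. *)
Definition hslm_step (R : realType) n m (prm : hslm_params R)
    (r : 'rV[R]_n -> 'rV[R]_m) (x : 'rV[R]_n) (mu : R) (I : hslm_data R n m)
    (x' : 'rV[R]_n) (mu' : R) : Prop :=
  [/\ orthonormal_cols (Vmx I),
      eta_min prm <= captured r x I,
      is_thin_svd (jac r x *m Vmx I) (Umx I) (sigma I) (Zmx I),
      ystep I *m Bmx prm mu I = - (r x *m Umx I *m diag_mx (sigma I))
    & forall j, first_armijo prm (half_sq r) x (sstep I) j ->
        let t := beta prm ^+ j in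
        x' = x + t *: sstep I /\
        mu' = update_mu prm mu (gain_ratio prm r x mu I (t *: sstep I))].

(* Iteration k is performed, i.e. the stopping test has failed up to k. The
   sequences below are total; their values past termination are irrelevant. *)
Definition performed (R : realType) n m (r : 'rV[R]_n -> 'rV[R]_m)
    (x : nat -> 'rV[R]_n) (k : nat) : Prop :=
  forall i, (i <= k)%N -> gradient (half_sq r) (x i) <> 0.

Definition hslm_run (R : realType) n m (prm : hslm_params R)
    (r : 'rV[R]_n -> 'rV[R]_m) (x0 : 'rV[R]_n) (x : nat -> 'rV[R]_n)
    (mu : nat -> R) (I : nat -> hslm_data R n m) : Prop :=
  [/\ x 0%N = x0, mu 0%N = mu0 prm
    & forall k, performed r x k ->
        hslm_step prm r (x k) (mu k) (I k) (x k.+1) (mu k.+1)].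

(* Main.v *)
(** Since [y B = - g V Z] with [B] diagonal and [mB <= B <= MB], the step [s]
    satisfies [mB |s|^2 <= - <g, s>] and [eta |g|^2 <= |g V|^2 <= - MB <g, s>].
    By the first bound and the Lipschitz gradient, every
    [t <= (1 - alpha) mB / L1] passes the Armijo test, a threshold independent
    of the iteration. So the backtracking steps are bounded below and each
    iteration decreases [F] by at least a fixed multiple of [|g|^2]; as [F] is
    bounded below, [|g|] tends to 0. *)

Require Import Defs.
From HB Require Import structures.
From mathcomp Require Import all_boot all_order all_algebra.
From mathcomp Require Import all_classical all_reals all_analysis.
From mathcomp Require Import lra.
Import Order.TTheory GRing.Theory Num.Theory.
Import numFieldNormedType.Exports.
Local Open Scope classical_set_scope.
Local Open Scope ring_scope.

(** * Euclidean inner product and norm *)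

Section dotv_theory.
Variables (R : realType) (n : nat).
Implicit Types (u v w : 'rV[R]_n) (a : R).

Lemma dotvE u v : dotv u v = \sum_j u 0 j * v 0 j.
Proof. by rewrite /dotv mxE; apply: eq_bigr => j _; rewrite mxE. Qed.

Lemma dotvC u v : dotv u v = dotv v u.
Proof. by rewrite !dotvE; apply: eq_bigr => j _; rewrite mulrC. Qed.

Lemma dotvDl u v w : dotv (u + v) w = dotv u w + dotv v w.
Proof. by rewrite /dotv mulmxDl mxE. Qed.

Lemma dotvNl u v : dotv (- u) v = - dotv u v.
Proof. by rewrite /dotv mulNmx mxE. Qed.

Lemma dotvZl a u v : dotv (a *: u) v = a * dotv u v.
Proof. by rewrite /dotv -scalemxAl mxE. Qed.

Lemma dotv_ge0 u : 0 <= dotv u u.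
Proof. by rewrite dotvE sumr_ge0 // => j _; rewrite -expr2 sqr_ge0. Qed.

Lemma sqr_enorm u : enorm u ^+ 2 = dotv u u.
Proof. by rewrite /enorm sqr_sqrtr ?dotv_ge0. Qed.

Lemma enorm_ge0 u : 0 <= enorm u.
Proof. exact: sqrtr_ge0. Qed.

Lemma enorm_eq0 u : enorm u = 0 -> u = 0.
Proof.
move=> u0; have /eqP := sqr_enorm u; rewrite u0 expr0n eq_sym dotvE.
rewrite psumr_eq0 => [/allP uj0|j _]; last by rewrite -expr2 sqr_ge0.
apply/rowP => j; rewrite mxE; apply/eqP.
by have := uj0 j (mem_index_enum _); rewrite /= mulf_eq0 orbb.
Qed.

Lemma enormZ a u : enorm (a *: u) = `|a| * enorm u.
Proof.
by rewrite /enorm dotvZl dotvC dotvZl mulrA -expr2 sqrtrM ?sqr_ge0// sqrtr_sqr.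
Qed.

(** Cauchy-Schwarz: expand the squared norm of [|v| u - |u| v], which is nonnegative, and cancel
    [|u| |v|]; the zero cases are treated apart. *)
Lemma dotv_le_enorm u v : dotv u v <= enorm u * enorm v.
Proof.
have [u0|u_neq0] := eqVneq (enorm u) 0.
  by rewrite u0 mul0r (enorm_eq0 _ u0) /dotv mul0mx mxE.
have [v0|v_neq0] := eqVneq (enorm v) 0.
  by rewrite v0 mulr0 (enorm_eq0 _ v0) dotvC /dotv mul0mx mxE.
have uv_gt0 : 0 < enorm u * enorm v.
  by rewrite mulr_gt0// lt0r ?u_neq0 ?v_neq0 enorm_ge0.
have := dotv_ge0 (enorm v *: u - enorm u *: v).
rewrite dotvDl dotvNl !dotvZl [dotv u (_ - _)]dotvC [dotv v (_ - _)]dotvC.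
rewrite !dotvDl !dotvNl !dotvZl -!sqr_enorm [dotv v u]dotvC => sq_ge0.
rewrite -(ler_pM2l uv_gt0); nra.
Qed.

End dotv_theory.

(** * Differential and gradient of the objective *)

(** Chain rule with the coordinate projection, packed as a linear map because a continuous linear
    map is its own differential. *)
Lemma is_diff_coord (R : realType) n m (r : 'rV[R]_n -> 'rV[R]_m) z j :
  differentiable r z ->
  is_diff z (fun w => r w 0 j) (fun v => ('d r z v) 0 j).
Proof.
move=> dr; pose c (w : 'rV[R]_m) : R := w 0 j.
have c_lin : linear c by move=> a u v; rewrite /c !mxE.
pose cL : {linear 'rV[R]_m -> R} :=
  HB.pack c (GRing.isLinear.Build _ _ _ _ _ c_lin).
have dc : is_diff (r z) (cL : _ -> _) cL.
  apply: DiffDef; first exact/linear_differentiable/coord_continuous.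
  by rewrite diff_lin//; exact: coord_continuous.
apply: DiffDef.
  exact: (@differentiable_comp _ _ _ _ r cL z dr (@ex_diff _ _ _ _ _ _ _ dc)).
rewrite (_ : (fun w => _) = cL \o r)// diff_comp//.
by rewrite (@diff_val _ _ _ _ _ _ _ dc).
Qed.

Lemma is_diff_sum (R : realType) (V W : normedModType R) k
    (f df : 'I_k -> V -> W) z :
  (forall j, is_diff z (f j) (df j)) ->
  is_diff z (\sum_(j < k) f j) (\sum_(j < k) df j).
Proof.
move=> df_f; elim/big_ind2 : _ => // [|f1 df1 f2 df2 d1 d2].
  exact: is_diff_cst.
exact: is_diffD.
Qed.

Lemma is_diff_half_sq (R : realType) n m (r : 'rV[R]_n -> 'rV[R]_m) z :
  differentiable r z ->
  is_diff z (half_sq r) (fun v => dotv (r z) ('d r z v)).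
Proof.
move=> dr.
(* Written with operations on functions, so that the rules for sums, powers and scalings of
   differentials apply. *)
have -> : half_sq r = 2^-1 *: \sum_(j < m) (fun w => r w 0 j) ^+ 2.
  apply/funext => w; rewrite /half_sq sqr_enorm dotvE [RHS]/GRing.scale/=.
  by rewrite fct_sumE.
have dj j : is_diff z ((fun w => r w 0 j) ^+ 2 : _ -> R)
    (2%:R * r z 0 j ^+ 1 *: (fun v => ('d r z v) 0 j)).
  by apply: is_diffX; exact: is_diff_coord.
apply: (is_diff_eq (is_diffZ _ (is_diff_sum _ _ _ _ _ _ _ dj))).
apply/funext => v; rewrite dotvE [LHS]/GRing.scale/= fct_sumE scaler_sumr.
apply: eq_bigr => j _.
change (2^-1 * (2 * r z 0 j ^+ 1 * ('d r z v) 0 j) = r z 0 j * ('d r z v) 0 j).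
by rewrite expr1 -mulrA mulKf// pnatr_eq0.
Qed.

(** Turns the vector of partial derivatives into the row form of [J^T r], on which the singular
    value decomposition acts. *)
Lemma gradient_half_sq (R : realType) n m (r : 'rV[R]_n -> 'rV[R]_m) z :
  differentiable r z -> gradient (half_sq r) z = r z *m jac r z.
Proof.
move=> dr; have dF := is_diff_half_sq _ _ _ _ _ dr.
apply/rowP => i; rewrite mxE deriveE; last exact: ex_diff.
rewrite diff_val /jac dotvE mxE; apply: eq_bigr => j _.
by rewrite !mxE.
Qed.

Lemma derive_gradient (R : realType) n (F : 'rV[R]_n -> R) z v :
  differentiable F z -> 'D_v F z = dotv (gradient F z) v.
Proof.
move=> dF; rewrite deriveE// {1}(row_sum_delta v) linear_sum dotvE.
by apply: eq_bigr => i _; rewrite linearZ mxE deriveE// mulrC.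
Qed.

(** The difference quotients of the restriction at [t] are those of [F] at [z + t v] in the
    direction [v]. *)
Lemma is_derive_line (R : realType) n (F : 'rV[R]_n -> R) z v t :
  differentiable F (z + t *: v) ->
  is_derive t 1 (fun u : R => F (z + u *: v))
    (dotv (gradient F (z + t *: v)) v).
Proof.
move=> dF; pose phi (u : R) := F (z + u *: v).
have quotient_eq :
    (fun h : R => h^-1 *: ((phi \o shift t) (h *: (1 : R)) - phi t)) =
    (fun h => h^-1 *: ((F \o shift (z + t *: v)) (h *: v) - F (z + t *: v))).
  apply/funext => h /=; congr (_ *: (F _ - _)).
  by rewrite [h *: 1]mulr1 scalerDl addrCA.
split; first by rewrite /derivable quotient_eq; exact: diff_derivable.
by rewrite /derive quotient_eq; exact: derive_gradient.
Qed.

(** * The Armijo inequality along a descent direction *)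

Section armijo_interval.
Variables (R : realType) (n : nat) (F : 'rV[R]_n -> R) (N : set 'rV[R]_n).
Variables (c L1 : R) (x s : 'rV[R]_n) (alpha a : R).
Hypothesis dF : forall z, differentiable F z.
Hypothesis N_open : open N.
Hypothesis sublevel_N : [set z | F z <= c] `<=` N.
Hypothesis L1_gt0 : 0 < L1.
Hypothesis gradF_lip : forall u v, N u -> N v ->
  enorm (gradient F u - gradient F v) <= L1 * enorm (u - v).
Hypothesis Fx_le : F x <= c.
Hypothesis alpha_bounds : 0 < alpha < 1.
Hypothesis a_gt0 : 0 < a.
Hypothesis s_descent : a * enorm s ^+ 2 <= - dotv (gradient F x) s.

Let T := (1 - alpha) * a / L1.

Let T_gt0 : 0 < T.
Proof.
case/andP: alpha_bounds => _ ?.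
by rewrite divr_gt0// mulr_gt0// subr_gt0.
Qed.

Let slope_le0 : dotv (gradient F x) s <= 0.
Proof. by rewrite -oppr_ge0 (le_trans _ s_descent)// mulr_ge0 ?sqr_ge0 ?ltW. Qed.

(** With [g] the gradient, [<g(x + t s) - g(x), s> <= L1 t |s|^2 <= (1 - alpha) a |s|^2 <= - (1 -
    alpha) <g(x), s>]; the middle inequality is what fixes the threshold [T]. *)
Let derive_le (t : R) : 0 <= t <= T -> N (x + t *: s) ->
  dotv (gradient F (x + t *: s)) s <= alpha * dotv (gradient F x) s.
Proof.
move=> /andP[t_ge0 t_leT] Nt.
have lip := gradF_lip _ _ Nt (sublevel_N _ Fx_le).
rewrite addrAC subrr add0r enormZ ger0_norm// in lip.
have := dotv_le_enorm _ _ (gradient F (x + t *: s) - gradient F x) s.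
rewrite dotvDl dotvNl => cs.
have {}cs := le_trans cs (ler_wpM2r (enorm_ge0 _ _ s) lip).
have tT : L1 * t <= (1 - alpha) * a by rewrite mulrC -ler_pdivlMr.
have := ler_wpM2r (sqr_ge0 (enorm s)) tT.
case/andP: alpha_bounds => _ alpha_lt1.
have alpha'_ge0 : 0 <= 1 - alpha by rewrite subr_ge0 ltW.
have := ler_wpM2l alpha'_ge0 s_descent.
move: cs; rewrite !expr2; lra.
Qed.

Let phi (t : R) := F (x + t *: s).

Let dphi (t : R) : is_derive t (1 : R) phi (dotv (gradient F (x + t *: s)) s).
Proof. exact: is_derive_line. Qed.

Let phi_cont : continuous phi.
Proof.
move=> t; apply/differentiable_continuous/derivable1_diffP.
exact: (@ex_derive _ _ _ _ _ _ _ (dphi t)).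
Qed.

(** Mean value theorem. The mean point is interior, so membership in [N] is asked on the open
    interval only. *)
Let phi_decrease (t u : R) : t <= u ->
  (forall w, t < w < u -> 0 <= w <= T /\ N (x + w *: s)) ->
  phi u - phi t <= alpha * (u - t) * dotv (gradient F x) s.
Proof.
rewrite le_eqVlt => /orP[/eqP->|tu]; first by rewrite !subrr mulr0 mul0r.
move=> good; have [w] := MVT tu (fun w _ => dphi w)
  (continuous_subspaceT phi_cont).
rewrite in_itv/= => /good[wT Nw] ->.
rewrite -mulrA [(u - t) * _]mulrC mulrA ler_wpM2r ?subr_ge0 ?(ltW tu)//.
exact: derive_le.
Qed.

(* The sublevel set is not convex and N is only an open neighborhood of it, so
   the Lipschitz bound is propagated along the ray by a supremum argument:
   while the ray stays in N, F decreases, hence the ray stays in the sublevel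
   set, whose neighborhood N leaves room to go further. *)
Let phi_le_c (t : R) : 0 <= t <= T -> phi t <= c.
Proof.
pose A := [set b | 0 <= b <= T /\ forall u, 0 <= u <= b -> phi u <= c].
have phi0 : phi 0 <= c by rewrite /phi scale0r addr0.
have A0 : A 0.
  split; first by rewrite lexx ltW.
  by move=> u u0; have -> : u = 0 by apply/eqP; rewrite eq_le andbC.
have A_ub : ubound A T by move=> b [/andP[]].
have A_sup : has_sup A by split; [exists 0 | exists T].
set tau := sup A.
have tau_ge0 : 0 <= tau by apply: ub_le_sup => //; exists T.
have tau_leT : tau <= T by apply: ge_sup => //; exists 0.
have below u : 0 <= u < tau -> phi u <= c.
  move=> /andP[u_ge0 /(sup_gt A_sup.1)[b [_ bA] ub]].
  by apply: bA; rewrite u_ge0 ltW.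
(* The supremum is attained: by continuity, [c < phi tau] would persist slightly to the left of
   [tau], against [below]. The maximum with 0 keeps the test point on the ray. *)
have at_tau : phi tau <= c.
  rewrite leNgt; apply/negP => c_lt.
  have tau_gt0 : 0 < tau.
    rewrite lt_neqAle tau_ge0 andbT; apply/eqP => tau0.
    by move: c_lt; rewrite -tau0 ltNge phi0.
  have /nbhs_ballP[e /= e_gt0 He] : nbhs tau [set u | c < phi u].
    exact: cvgr_gt (phi_cont tau) _ c_lt.
  pose u := Num.max 0 (tau - e / 2).
  have u_lt : u < tau by rewrite /u gt_max tau_gt0/=; lra.
  have u_ge : tau - e / 2 <= u by rewrite /u le_max lexx orbT.
  have : c < phi u.
    apply: He; rewrite /ball/= ger0_norm; lra.
  by rewrite ltNge below// u_lt /u le_max lexx.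
have tau_A : A tau.
  split; first by rewrite tau_ge0.
  move=> u /andP[u_ge0]; rewrite le_eqVlt => /orP[/eqP->//|u_lt].
  by apply: below; rewrite u_ge0.
have [tau_T|tau_neq] := eqVneq tau T.
  by move=> tT; apply: tau_A.2; rewrite tau_T.
have tau_ltT : tau < T by rewrite lt_neqAle tau_neq.
(* The point at [tau] lies in the sublevel set, hence in the open set [N], so the ray stays in [N] a
   little beyond [tau]; [b] will then contradict the maximality of [tau]. *)
have /nbhs_ballP[e /= e_gt0 He] : nbhs tau [set u | N (x + u *: s)].
  have line_cont : {for tau, continuous (fun u : R => x + u *: s)}.
    apply: cvgD; first exact: cvg_cst.
    by apply: cvgZl; exact: cvg_id.
  apply: line_cont; apply: open_nbhs_nbhs; split=> //.
  exact: sublevel_N.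
pose b := Num.min T (tau + e / 2).
have b_gt : tau < b by rewrite /b lt_min tau_ltT/=; lra.
have b_le : b <= tau + e / 2 by rewrite /b ge_min lexx orbT.
have b_leT : b <= T by rewrite /b ge_min lexx.
suff bA : A b.
  have : b <= tau by apply: ub_le_sup => //; exists T.
  by rewrite leNgt b_gt.
split; first by rewrite b_leT andbT; lra.
move=> u /andP[u_ge0 u_le].
have [u_tau|tau_u] := leP u tau; first by apply: tau_A.2; rewrite u_ge0.
(* Between [tau] and [u] the ray is in [N], so [phi] does not increase there and stays below
   [phi tau <= c]. *)
have : phi u - phi tau <= alpha * (u - tau) * dotv (gradient F x) s.
  apply: phi_decrease; first exact: ltW.
  move=> w /andP[tau_w w_u]; split; first by lra.
  apply: He; rewrite /ball/= ltr0_norm; lra.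
case/andP: alpha_bounds => alpha_gt0 _ dec.
rewrite -subr_le0 in at_tau *.
have : alpha * (u - tau) * dotv (gradient F x) s <= 0.
  by rewrite mulr_ge0_le0// mulr_ge0 ?subr_ge0 ?ltW.
lra.
Qed.

(** The whole segment is now known to lie in the sublevel set, hence in [N], so one mean value
    estimate from 0 to [t] suffices. *)
Lemma armijo_interval (t : R) : 0 <= t <= (1 - alpha) * a / L1 ->
  F (x + t *: s) <= F x + alpha * t * dotv (gradient F x) s.
Proof.
move=> /andP[t_ge0 t_leT]; rewrite -lerBlDl.
have := phi_decrease 0 t t_ge0; rewrite subr0 /phi scale0r addr0; apply.
move=> w /andP[w_gt0 w_lt].
have wT : 0 <= w <= T by rewrite ltW//= (le_trans (ltW w_lt)).
by split=> //; apply: sublevel_N; exact: phi_le_c.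
Qed.

End armijo_interval.

(** * Spectral bounds and the reduced step *)

Lemma enorm_orthonormal (R : realType) p q (v : 'rV[R]_p) (A : 'M[R]_(q, p)) :
  orthonormal_cols A -> enorm (v *m A^T) = enorm v.
Proof.
move=> A_orth; rewrite /enorm /dotv trmx_mul trmxK -mulmxA [A^T *m _]mulmxA.
by rewrite A_orth mul1mx.
Qed.

Lemma eigenvalue_diag_mx (R : realType) p (d : 'rV[R]_p) a :
  eigenvalue (diag_mx d) a <-> exists i, d 0 i = a.
Proof.
split=> [/eigenvalueP[v /rowP va v_neq0]|[i <-]].
  have [i vi_neq0] : exists i, v 0 i != 0 by apply/rV0Pn.
  exists i; apply: (mulfI vi_neq0).
  by have := va i; rewrite mul_mx_diag !mxE => ->; exact: mulrC.
apply/eigenvalueP; exists (delta_mx 0 i).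
  apply/rowP => j; rewrite mul_mx_diag !mxE eqxx/= mulrC.
  by case: eqVneq => [->|_]//; rewrite !mulr0.
by apply/rV0Pn; exists i; rewrite mxE !eqxx oner_neq0.
Qed.

(** An infimum or supremum bounds its members only if the set is bounded on that side; the sum of
    the [|d_k|] bounds the eigenvalues on both. *)
Lemma lambda_bounds_diag_mx (R : realType) p (d : 'rV[R]_p) i :
  lambda_min (diag_mx d) <= d 0 i <= lambda_max (diag_mx d).
Proof.
have di : [set a | eigenvalue (diag_mx d) a] (d 0 i).
  by apply/eigenvalue_diag_mx; exists i.
have abs_le j : `|d 0 j| <= \sum_k `|d 0 k|.
  by rewrite (bigD1 j)//= lerDl sumr_ge0.
apply/andP; split; [apply: ge_inf => //|apply: ub_le_sup => //].
  exists (- \sum_k `|d 0 k|) => a /eigenvalue_diag_mx[j <-].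
  by rewrite lerNl (le_trans _ (abs_le j))// -normrN ler_norm.
exists (\sum_k `|d 0 k|) => a /eigenvalue_diag_mx[j <-].
by rewrite (le_trans _ (abs_le j))// ler_norm.
Qed.

(** In the basis [V Z] the gradient has coordinates [- b_i y_i], so [- <g, s>] is the sum of the
    [b_i y_i^2]. The claims follow termwise from [mB y_i^2 <= b_i y_i^2] and
    [b_i^2 y_i^2 <= MB b_i y_i^2]. *)
Lemma hslm_direction (R : realType) n m (prm : hslm_params R) (mu mB MB : R)
    (I : hslm_data R n m) (rx : 'rV[R]_m) (J : 'M[R]_(m, n)) :
  orthonormal_cols (Vmx I) ->
  is_thin_svd (J *m Vmx I) (Umx I) (sigma I) (Zmx I) ->
  ystep I *m Bmx prm mu I = - (rx *m Umx I *m diag_mx (sigma I)) ->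
  0 < mB -> mB <= lambda_min (Bmx prm mu I) ->
  lambda_max (Bmx prm mu I) <= MB ->
  mB * enorm (sstep I) ^+ 2 <= - dotv (rx *m J) (sstep I) /\
  enorm (rx *m J *m Vmx I) ^+ 2 <= MB * - dotv (rx *m J) (sstep I).
Proof.
move=> V_orth [U_orth Z_orth sigma_ge0 JV] yB mB_gt0 mB_le le_MB.
pose b : 'rV[R]_(dimp I) :=
  \row_i (sigma I 0 i * sigma I 0 i + mu * dvec prm I 0 i).
have B_diag : Bmx prm mu I = diag_mx b.
  apply/matrixP => i j; rewrite /Bmx mul_diag_mx !mxE.
  by case: eqVneq => [->|_]; rewrite ?mulr1n ?mulr0n ?mulr0 ?addr0.
have b_bounds i : mB <= b 0 i <= MB.
  have := lambda_bounds_diag_mx _ _ b i; rewrite -B_diag => /andP[b_min b_max].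
  by rewrite (le_trans mB_le)// (le_trans b_max).
(* Orthogonality of [Z] gives [J V Z = U diag(sigma)], so the equation defining [y] reads off the
   reduced gradient. *)
have gVZ : rx *m J *m (Vmx I *m Zmx I) = - (ystep I *m diag_mx b).
  rewrite -B_diag yB opprK -mulmxA [J *m _]mulmxA JV -!mulmxA Z_orth.
  by rewrite mulmx1.
have slope : - dotv (rx *m J) (sstep I) = \sum_i b 0 i * ystep I 0 i ^+ 2.
  have -> : dotv (rx *m J) (sstep I) =
            dotv (rx *m J *m (Vmx I *m Zmx I)) (ystep I).
    by rewrite /dotv [(sstep I)^T]trmx_mul trmxK !mulmxA.
  rewrite gVZ dotvNl opprK dotvE; apply: eq_bigr => i _.
  by rewrite mul_mx_diag mxE mulrAC mulrC expr2.
rewrite slope; split.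
  have -> : enorm (sstep I) = enorm (ystep I).
    by rewrite /sstep trmx_mul mulmxA enorm_orthonormal// enorm_orthonormal.
  rewrite sqr_enorm dotvE mulr_sumr; apply: ler_sum => i _.
  by rewrite -expr2 ler_wpM2r ?sqr_ge0//; case/andP: (b_bounds i).
(* As [Z] is square, its rows are orthonormal too, and [g V] has the same norm as [g V Z]. *)
have Zt_orth : orthonormal_cols (Zmx I)^T.
  by rewrite /orthonormal_cols trmxK; exact: mulmx1C.
rewrite -(enorm_orthonormal _ _ _ _ _ Zt_orth) trmxK -mulmxA gVZ.
rewrite sqr_enorm dotvE mulr_sumr; apply: ler_sum => i _.
rewrite mul_mx_diag mxE [X in - X]mxE mulrNN mulrACA -!expr2 mulrC expr2 -mulrA.
have /andP[mB_b b_MB] := b_bounds i.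
by rewrite ler_wpM2r// mulr_ge0 ?sqr_ge0// (le_trans (ltW mB_gt0)).
Qed.

(** * Backtracking, and convergence from sufficient decrease *)

(** The powers of [beta] tend to 0, so some trial step is accepted. The first accepted one is 1, or
    its predecessor was rejected and so exceeds [T]. *)
Lemma first_armijo_lower_bound (R : realType) n (prm : hslm_params R)
    (F : 'rV[R]_n -> R) x s (T : R) :
  0 < T -> (forall t, 0 <= t <= T -> armijo prm F x s t) ->
  exists2 j, first_armijo prm F x s j & Num.min 1 (beta prm * T) <= beta prm ^+ j.
Proof.
move=> T_gt0 armijo_T; have /andP[beta_gt0 beta_lt1] := beta_bounds prm.
have betaX_ge0 j : 0 <= beta prm ^+ j by rewrite exprn_ge0 ?ltW.
have [j0 j0T] : exists j, beta prm ^+ j <= T.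
  have betaX_cvg : (fun j => beta prm ^+ j) @ \oo --> (0 : R).
    by apply: cvg_expr; rewrite ger0_norm ?ltW.
  have [j _ /(_ j (leqnn j)) jT] := cvgr_lt _ betaX_cvg _ T_gt0.
  by exists j; exact: ltW.
pose P j := F (x + beta prm ^+ j *: s) <=
  F x + alpha prm * beta prm ^+ j * dotv (gradient F x) s.
have Pj0 : exists j, P j by exists j0; apply: armijo_T; rewrite betaX_ge0.
case: (ex_minnP Pj0) => j Pj j_min; exists j.
  by split=> // i ij /j_min; rewrite leqNgt ij.
case: j Pj j_min => [|j] Pj j_min; first by rewrite expr0 ge_min lexx.
have T_lt : T < beta prm ^+ j.
  rewrite ltNge; apply/negP => jT.
  have /j_min : P j by apply: armijo_T; rewrite betaX_ge0.
  by rewrite ltnn.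
by rewrite ge_min exprS ler_pM2l// (ltW T_lt) orbT.
Qed.

(** The sequence [f] is nonincreasing and bounded below, so its successive differences tend to 0;
    they dominate [K g^2]. *)
Lemma sufficient_decrease_cvg0 (R : realType) (f g : nat -> R) (K : R) :
  0 < K -> has_lbound (range f) -> (forall k, 0 <= g k) ->
  (forall k, f k.+1 <= f k - K * g k ^+ 2) -> g @ \oo --> (0 : R).
Proof.
move=> K_gt0 f_lb g_ge0 f_dec.
have f_cvg : cvgn f.
  apply: nonincreasing_is_cvgn => //; apply/nonincreasing_seqP => k.
  by rewrite (le_trans (f_dec k))// gerBl mulr_ge0 ?sqr_ge0 ?ltW.
have dif_cvg : (fun k => K^-1 * (f k - f k.+1)) @ \oo --> (0 : R).
  rewrite -(mulr0 K^-1) -(subrr (limn f)).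
  apply: cvgMr; apply: cvgB => //.
  by rewrite (cvg_shiftS f).
have sqr_cvg : (fun k => g k ^+ 2) @ \oo --> (0 : R).
  apply: (squeeze_cvgr _ (cvg_cst 0) dif_cvg); apply: nearW => k.
  rewrite sqr_ge0/= ler_pdivlMl// lerBrDr addrC -lerBrDr.
  exact: f_dec.
have -> : g = (fun k => Num.sqrt (g k ^+ 2)).
  by apply/funext => k; rewrite sqrtr_sqr ger0_norm.
rewrite -sqrtr0; exact: (continuous_cvg _ (@sqrt_continuous R 0) sqr_cvg).
Qed.

(** * Decrease along a run and convergence of the gradients *)

Section run.
Variables (R : realType) (n m : nat) (r : 'rV[R]_n -> 'rV[R]_m).
Variables (prm : hslm_params R) (N : set 'rV[R]_n) (c L1 eta mB MB : R).
Hypothesis r_diff : forall z, differentiable r z.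
Hypothesis N_open : open N.
Hypothesis sublevel_N : [set z | half_sq r z <= c] `<=` N.
Hypothesis L1_gt0 : 0 < L1.
Hypothesis gradF_lip : forall u v, N u -> N v ->
  enorm (gradient (half_sq r) u - gradient (half_sq r) v) <= L1 * enorm (u - v).
Hypothesis eta_gt0 : 0 < eta.
Hypothesis mB_gt0 : 0 < mB.
Hypothesis MB_gt0 : 0 < MB.

Let F := half_sq r.

(** The constant collects the Armijo factor [alpha], the lower bound on the accepted step, and the
    ratio [eta / MB] of [- <g, s>] to [|g|^2]. *)
Lemma hslm_step_decrease (x x' : 'rV[R]_n) (mu mu' : R) (I : hslm_data R n m) :
  F x <= c -> gradient F x <> 0 -> hslm_step prm r x mu I x' mu' ->
  eta <= captured r x I ->
  mB <= lambda_min (Bmx prm mu I) -> lambda_max (Bmx prm mu I) <= MB ->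
  F x' <= F x -
    alpha prm * Num.min 1 (beta prm * ((1 - alpha prm) * mB / L1)) * eta / MB *
    enorm (gradient F x) ^+ 2.
Proof.
move=> Fx_le g_neq0 [V_orth _ svd yB next] eta_le mB_le le_MB.
have F_diff z : differentiable F z.
  exact: (@ex_diff _ _ _ _ _ _ _ (is_diff_half_sq _ _ _ _ _ (r_diff z))).
have [] := hslm_direction _ _ _ _ _ _ _ _ _ _ V_orth svd yB mB_gt0 mB_le le_MB.
rewrite -gradient_half_sq// -/F => s_descent gV_le.
have /andP[alpha_gt0 alpha_lt1] := alpha_bounds prm.
have /andP[beta_gt0 _] := beta_bounds prm.
set T := (1 - alpha prm) * mB / L1.
have T_gt0 : 0 < T by rewrite divr_gt0// mulr_gt0// subr_gt0.
have armijo_T t : 0 <= t <= T -> armijo prm F x (sstep I) t.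
  apply: (armijo_interval _ _ F N c L1) => //; exact: alpha_bounds.
have [j first_j t_ge] :=
  first_armijo_lower_bound _ _ _ _ _ _ _ T_gt0 armijo_T.
(* The step relation determines the new iterate only through a first admissible exponent, whose
   existence has just been proved. *)
have [-> _] := next j first_j.
apply: (le_trans first_j.1).
have g_gt0 : 0 < enorm (gradient F x).
  by rewrite lt0r enorm_ge0 andbT; apply/eqP => /enorm_eq0.
have g2_le : eta * enorm (gradient F x) ^+ 2 <=
    MB * - dotv (gradient F x) (sstep I).
  by apply: le_trans gV_le; rewrite -ler_pdivlMr// exprn_gt0.
have D_ge : eta / MB * enorm (gradient F x) ^+ 2 <=
    - dotv (gradient F x) (sstep I).
  by rewrite mulrAC ler_pdivrMr// [X in _ <= X]mulrC.
rewrite lerD2l -[X in X <= _]opprK -mulrN lerN2 -[X in X / MB]mulrA.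
rewrite -!mulrA ler_pM2l//.
apply: ler_pM => //.
- by rewrite le_min ler01 mulr_ge0 ?ltW.
- by rewrite !mulr_ge0 ?invr_ge0 ?sqr_ge0 ?ltW.
- by rewrite mulrA.
Qed.

End run.

Theorem theorem1 (R : realType) (n m : nat) (r : 'rV[R]_n -> 'rV[R]_m)
  (prm : hslm_params R) (x0 : 'rV[R]_n)
  (x : nat -> 'rV[R]_n) (mu : nat -> R) (I : nat -> hslm_data R n m)
  (r_C1 : continuously_differentiable r)
  (run : hslm_run prm r x0 x mu I)
  (F_bounded_below :
     has_lbound (half_sq r @` [set z | half_sq r z <= half_sq r x0]))
  (gradient_lipschitz :
     exists N : set 'rV[R]_n,
       [/\ open N,
           [set z | half_sq r z <= half_sq r x0] `<=` N
         & exists2 L1 : R, 0 < L1 &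
             forall u v, N u -> N v ->
               enorm (gradient (half_sq r) u - gradient (half_sq r) v)
                 <= L1 * enorm (u - v)])
  (subspace_quality :
     exists2 eta : R, 0 < eta <= 1 &
       forall k, performed r x k -> eta <= captured r (x k) (I k))
  (B_bounds :
     exists mB MB : R, 0 < mB /\
       forall k, performed r x k ->
         mB <= lambda_min (Bmx prm (mu k) (I k)) /\
         lambda_min (Bmx prm (mu k) (I k)) <= lambda_max (Bmx prm (mu k) (I k)) /\
         lambda_max (Bmx prm (mu k) (I k)) <= MB) :
  (exists k, gradient (half_sq r) (x k) = 0) \/
  limn_einf (fun k => (enorm (gradient (half_sq r) (x k)))%:E) = 0%E.
Proof.
have [stop|nostop] := pselect (exists k, gradient (half_sq r) (x k) = 0).
  by left.
right; have g_neq0 k : gradient (half_sq r) (x k) <> 0.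
  by move=> gk0; apply: nostop; exists k.
have perf k : performed r x k by move=> i _.
case: run => x_0 _ step.
case: gradient_lipschitz => N [N_open sub_N [L1 L1_gt0 lip]].
case: subspace_quality => eta /andP[eta_gt0 _] eta_le.
case: B_bounds => mB [MB [mB_gt0 B_le]].
(* Read off at iteration 0, which is performed since the run never stops. *)
have MB_gt0 : 0 < MB.
  have [mB0 [minmax maxMB]] := B_le 0%N (perf 0%N).
  exact: lt_le_trans mB_gt0 (le_trans mB0 (le_trans minmax maxMB)).
have /andP[alpha_gt0 alpha_lt1] := alpha_bounds prm.
have /andP[beta_gt0 _] := beta_bounds prm.
set F := half_sq r; set c := F x0.
pose K := alpha prm * Num.min 1 (beta prm * ((1 - alpha prm) * mB / L1)) *
  eta / MB.
have K_gt0 : 0 < K.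
  by rewrite divr_gt0// !mulr_gt0// lt_min ltr01 !mulr_gt0 ?invr_gt0 ?subr_gt0.
have dec k : F (x k) <= c ->
    F (x k.+1) <= F (x k) - K * enorm (gradient F (x k)) ^+ 2.
  have [mB_le [_ le_MB]] := B_le k (perf k) => Fx_le.
  exact: (hslm_step_decrease _ _ _ r prm N c L1 eta mB MB r_C1.1 N_open sub_N
    L1_gt0 lip eta_gt0 mB_gt0 MB_gt0 _ _ _ _ _ Fx_le (g_neq0 k)
    (step k (perf k)) (eta_le k (perf k)) mB_le le_MB).
(* The decrease is available only inside the sublevel set, and keeps the next iterate there: hence
   the induction. *)
have Fx_le k : F (x k) <= c.
  elim: k => [|k IHk]; first by rewrite x_0.
  by apply: le_trans (dec k IHk) (le_trans _ IHk);
     rewrite gerBl mulr_ge0 ?sqr_ge0 ?ltW.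
have g_cvg : (fun k => enorm (gradient F (x k))) @ \oo --> (0 : R).
  apply: (sufficient_decrease_cvg0 _ (F \o x) _ K) => //.
  - case: F_bounded_below => l l_lb; exists l => _ [k _ <-].
    by apply: l_lb; exists (x k) => //; exact: Fx_le.
  - by move=> k; exact: enorm_ge0.
  - by move=> k; exact: dec.
(* The full limit is 0, so the lower limit, taken in the extended reals, is 0 as well. *)
by apply: (cvg_limn_einf_sup _).1; apply/fine_cvgP; split=> //; exact: nearW.
Qed.
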